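(* Let $\bar{a} = \langle a^{i} : i < \omega \rangle$ be a sequence of conditionally convergent real-valued series, where $a^{i} = \langle a^{i}_{n} : n \in \omega\rangle$. Then \[S(\bar{a}) = \left\{ \left\langle \sum_{n\in\omega} a^{i}_{n} : i < \omega \right\rangle + \bar{x} \;:\; \bar{x} \in R(\bar{a})\right\}.\]
   Context: Here $\omega = \{0,1,2,\dots\}$. A real series is identified with its sequence of terms $a = \langle a_n : n\in\omega\rangle$, and $\sum a$ denotes $\sum_{n\in\omega} a_n = \lim_{N\to\infty}\sum_{n<N} a_n$. A series is conditionally convergent if it converges but does not converge absolutely. Linear combinations of series are taken termwise. For a sequence $\bar{a} = \langle a^{i} : i < \omega\rangle$ of real series: - $K(\bar{a})$ is the set of $\langle s_{i} : i < \omega\rangle \in \mathbb{R}^{\omega}$ such that $\{ i \in \omega : s_{i} \neq 0\}$ is finite and the series $\sum_{i\in \omega}s_{i}a^{i}$ (the series with $n$-th term $\sum_{i} s_i a^i_n$) is absolutely convergent. - $R(\bar{a})$ is the orthogonal complement of $K(\bar{a})$ in $\mathbb{R}^\omega$, i.e. the set of $\langle x_i : i<\omega\rangle \in \mathbb{R}^{\omega}$ such that $\sum_{i\in\omega} x_i s_i = 0$ for every $\langle s_i : i<\omega\rangle \in K(\bar{a})$ (each such sum has only finitely many nonzero terms). - $S(\bar{a})$ is the set of values in $\mathbb{R}^{\omega}$ of the form $\sum_{n \in \omega} \langle a^{i}_{p(n)} : i < \omega \rangle$ for $p$ a permutation of $\omega$, where convergence in $\mathbb{R}^\omega$ is pointwise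 (coordinatewise). That is, $\langle y_i : i<\omega\rangle \in S(\bar a)$ if and only if there is a permutation (bijection) $p$ of $\omega$ such that for every $i<\omega$ the series $\sum_{n\in\omega} a^i_{p(n)}$ converges to $y_i$. *)

(* Defs.v *)
From mathcomp Require Import all_boot all_order all_algebra.
From mathcomp Require Import all_classical all_reals all_analysis.
Set Implicit Arguments.
Unset Strict Implicit.
Unset Printing Implicit Defensive.
Import Order.TTheory GRing.Theory Num.Theory.
Import numFieldNormedType.Exports.
Local Open Scope classical_set_scope.
Local Open Scope ring_scope.

(* A real series is represented by its sequence of terms [u : R ^nat];
   [a i n] is the n-th term of the i-th series. *)

Definition abs_convergent (R : realType) (u : R ^nat) : Prop :=
  cvgn [normed series u].

Definition cond_convergent (R : realType) (u : R ^nat) : Prop :=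
  cvgn (series u) /\ ~ abs_convergent u.

(* In the next two definitions the sum over [i \in setT] is the library's sum
   of finitely many nonzero terms (it is 0 by convention on infinite supports,
   a case excluded here by the finiteness of the support of [s]). *)
Definition Kspace (R : realType) (a : nat -> R ^nat) : set (nat -> R) :=
  [set s | finite_set [set i | s i != 0] /\
           abs_convergent (fun n => \sum_(i \in [set: nat]) s i * a i n)].

Definition Rspace (R : realType) (a : nat -> R ^nat) : set (nat -> R) :=
  [set x | forall s, Kspace a s -> \sum_(i \in [set: nat]) x i * s i = 0].

Definition sum_range (R : realType) (a : nat -> R ^nat) : set (nat -> R) :=
  [set y | exists2 p : nat -> nat, bijective p &
           forall i, series (fun n => a i (p n)) @ \oo --> y i].

(* Main.v *)
(** S(a) is contained in the right-hand side because an absolutely convergent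
    combination of the series is insensitive to rearrangement.

    Conversely, let t be the sum of the series shifted by x in R(a).  Fix the
    first d coordinates, and let v_n be the n-th vector of terms.  The sums
    Sum c_n v_n with finitely supported weights c_n in [0, 1] vanishing for
    n < M form a convex set.  If x were not in its closure, a separating
    functional s would bound the sums of the positive parts of s . v_n, so that
    s in K(a) and s . x = 0, which contradicts separation since 0 is in the
    set.  Making all but d of the weights equal to 0 or 1, x is approximated by
    sums over finite subsets of any tail.  Hence the finite sets F_k = initial
    segment + finite set can be chosen increasing with sums tending to t in more
    and more coordinates, and Steinitz' ordering of each F_(k+1) \ F_k keeps the
    intermediate partial sums close to t. *)
Require Import Defs.
From mathcomp Require Import all_boot all_order all_algebra.
From mathcomp Require Import all_classical all_reals all_analysis.
From mathcomp Require Import ring lra zify.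
Set Implicit Arguments.
Unset Strict Implicit.
Unset Printing Implicit Defensive.
Import Order.TTheory GRing.Theory Num.Theory.
Import numFieldNormedType.Exports.
Local Open Scope classical_set_scope.
Local Open Scope ring_scope.

(** * Fractional weights, rounding and Steinitz' ordering *)

Lemma seq_argmin (R : realDomainType) (T : eqType) (f : T -> R) (s : seq T) :
  s != [::] -> exists2 x, x \in s & {in s, forall y, f x <= f y}.
Proof.
elim: s => // x s IH _; case: (eqVneq s [::]) => [->|/IH[y ys ymin]].
  by exists x; rewrite ?mem_head // => z; rewrite inE => /eqP->.
case: (leP (f x) (f y)) => [xy|/ltW yx].
  exists x; rewrite ?mem_head // => z; rewrite inE => /predU1P[->//|/ymin].
  exact: le_trans.
by exists y; rewrite ?inE ?ys ?orbT // => z; rewrite inE => /predU1P[->//|/ymin].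
Qed.

(** The vectors form a matrix of rank at most [d] with more than [d] rows, so its left kernel
    contains a nonzero row. *)
Lemma linear_dependence (F : fieldType) (T : eqType) (A : seq T) (d : nat)
    (w : T -> nat -> F) : uniq A -> (d < size A)%N ->
  exists2 u : T -> F, (exists2 x, x \in A & u x != 0) &
    forall i, (i < d)%N -> \sum_(x <- A) u x * w x i = 0.
Proof.
move=> uA dA.
pose M := \matrix_(j < size A, i < d) w (tnth (in_tuple A) j) i.
have kM : kermx M != 0.
  by rewrite -mxrank_eq0 mxrank_ker subn_eq0 -ltnNge (leq_ltn_trans (rank_leq_col M)).
pose v := nz_row (kermx M).
have v0 : v != 0 by rewrite nz_row_eq0.
have vM : v *m M = 0 by apply/sub_kermxP; exact: nz_row_sub.
pose u x := if insub (index x A) is Some k then v 0 k else 0.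
have uE k : u (tnth (in_tuple A) k) = v 0 k.
  have kA := ltn_ord k.
  rewrite /u (tnth_nth (tnth (in_tuple A) k)) /= index_uniq //.
  by case: insubP => [j _ /val_inj->//|]; rewrite kA.
exists u.
  have [k vk] := rV0Pn _ v0.
  by exists (tnth (in_tuple A) k); [exact: mem_tnth|rewrite uE].
move=> i id; rewrite big_tnth.
have /matrixP/(_ 0 (Ordinal id)) := vM; rewrite !mxE => vMi; rewrite -[RHS]vMi.
by apply: eq_bigr => k _; rewrite uE mxE.
Qed.

Section Vertex.
Variables (R : realFieldType) (T : eqType).

(* [t] is the first time at which the line [c + t u] leaves the cube. *)
Lemma exit_cube (A : seq T) (c u : T -> R) :
  {in A, forall x, 0 < c x < 1} -> (exists2 x, x \in A & u x != 0) ->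
  exists t, {in A, forall x, 0 <= c x + t * u x <= 1} /\
    exists2 x, x \in A & ~~ (0 < c x + t * u x < 1).
Proof.
move=> cA [x0 x0A ux0].
(* Time at which coordinate [x] reaches the face of [0, 1] that it moves towards; meaningless where
   [u x] vanishes, hence the filter below. *)
pose tau x := (if 0 < u x then 1 - c x else c x) / `|u x|.
have [|z] := @seq_argmin R T tau [seq x <- A | u x != 0].
  by rewrite -has_filter; apply/hasP; exists x0.
rewrite mem_filter => /andP[uz zA] zmin.
have tauP x : 0 < u x -> tau x = (1 - c x) / u x.
  by move=> ux; rewrite /tau ux gtr0_norm.
have tauN x : u x < 0 -> tau x = c x / - u x.
  by move=> ux; rewrite /tau ltNge (ltW ux) ltr0_norm.
have tau0 x : x \in A -> u x != 0 -> 0 < tau x.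
  move=> xA ux; have /andP[c0 c1] := cA _ xA.
  by rewrite divr_gt0 ?normr_gt0//; case: ifP => _; lra.
have tz0 := tau0 _ zA uz.
exists (tau z); split.
  move=> x xA; have /andP[c0 c1] := cA _ xA.
  have [->|unx] := eqVneq (u x) 0; first by rewrite mulr0 addr0 !ltW.
  have {zmin}: tau z <= tau x by apply: zmin; rewrite mem_filter unx.
  case: (ltP (u x) 0) => [ux|].
    rewrite (tauN x)// ler_pdivlMr ?oppr_gt0// => h.
    have := mulr_gt0 tz0 (_ : 0 < - u x); rewrite oppr_gt0 => /(_ ux) h'.
    by apply/andP; split; lra.
  rewrite le_eqVlt eq_sym (negPf unx) => /= ux; rewrite (tauP x)// ler_pdivlMr// => h.
  have := mulr_gt0 tz0 ux => h'.
  by apply/andP; split; lra.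
exists z => //; case: (ltP (u z) 0) => [ux|].
  by rewrite tauN// invrN mulrN mulNr divfK// subrr ltxx.
rewrite le_eqVlt eq_sym (negPf uz) => /= ux.
by rewrite tauP// divfK// addrC subrK ltxx andbF.
Qed.

(** While more than [d] weights are fractional, a linear dependence among their vectors gives a
    direction preserving all the sums. Following it to the boundary of the cube makes a weight
    integral and changes no integral weight. *)
Lemma few_fractional (A : seq T) (c : T -> R) (w : T -> nat -> R) (d : nat) :
  uniq A -> {in A, forall x, 0 <= c x <= 1} ->
  exists c' : T -> R, [/\ {in A, forall x, 0 <= c' x <= 1},
    forall i, (i < d)%N -> \sum_(x <- A) c' x * w x i = \sum_(x <- A) c x * w x i &
    (count (fun x => 0 < c' x < 1)%R A <= d)%N].
Proof.
move=> uA.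
have [m] := ubnP (count (fun x => 0 < c x < 1) A).
elim: m c => // m IH c cm cA.
case: (leqP (count (fun x => 0 < c x < 1) A) d) => [cd|dc]; first by exists c.
pose B := [seq x <- A | 0 < c x < 1].
have uB : uniq B by rewrite filter_uniq.
have dB : (d < size B)%N by rewrite size_filter.
have [u unz u0] := linear_dependence w uB dB.
have cB : {in B, forall x, 0 < c x < 1} by move=> x; rewrite mem_filter => /andP[].
have [t [tB [z zB zt]]] := exit_cube cB unz.
pose c1 x := if x \in B then c x + t * u x else c x.
have c1A : {in A, forall x, 0 <= c1 x <= 1}.
  by move=> x xA; rewrite /c1; case: ifP => [/tB//|_]; exact: cA.
have c1sub x : x \in A -> 0 < c1 x < 1 -> 0 < c x < 1.
  by move=> xA; rewrite /c1; case: ifP => [/cB//|_].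
have [] := IH c1 _ c1A.
  rewrite -ltnS; apply: leq_trans cm; rewrite ltnS.
  move: zB; rewrite mem_filter => /andP[cz zA].
  have zB : z \in B by rewrite mem_filter cz.
  have := @uniq_leq_size _ (z :: [seq x <- A | 0 < c1 x < 1]) B.
  rewrite /= filter_uniq// andbT /B !size_filter; apply.
    by rewrite mem_filter zA andbT /c1 zB.
  move=> x; rewrite inE => /predU1P[->//|]; rewrite !mem_filter.
  by case/andP => /c1sub h xA; rewrite h.
move=> c' [c'A c'w c'd]; exists c'; split=> // i id.
rewrite c'w //.
transitivity (\sum_(x <- A)
  (c x * w x i + if 0 < c x < 1 then t * (u x * w x i) else 0)).
  apply: eq_big_seq => x xA; rewrite /c1 mem_filter xA andbT; case: ifP => _; ring.
rewrite big_split /= -big_mkcond -mulr_sumr -[X in t * X]big_filter -/B u0//.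
by rewrite mulr0 addr0.
Qed.

Lemma ler_norm_sum_in (A : seq T) (F G : T -> R) :
  {in A, forall x, `|F x| <= G x} -> `|\sum_(x <- A) F x| <= \sum_(x <- A) G x.
Proof.
move=> FG; apply: le_trans (ler_norm_sum _ _ _) _.
by rewrite big_seq [leRHS]big_seq; apply: ler_sum.
Qed.

Lemma natr_count (A : seq T) (P : pred T) :
  (count P A)%:R = \sum_(x <- A) (P x)%:R :> R.
Proof.
by rewrite -sum1_count natr_sum big_mkcond; apply: eq_bigr => x _; case: (P x).
Qed.

(** Only the indices of final weight 1 are kept; each of the at most [d] fractional ones then costs
    at most [delta]. *)
Lemma subset_rounding (A : seq T) (c : T -> R) (w : T -> nat -> R) (d : nat)
    (delta : R) :
  uniq A -> {in A, forall x, 0 <= c x <= 1} -> 0 <= delta ->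
  (forall x i, x \in A -> (i < d)%N -> `|w x i| <= delta) ->
  exists P : pred T, forall i, (i < d)%N ->
    `|\sum_(x <- A | P x) w x i - \sum_(x <- A) c x * w x i| <= d%:R * delta.
Proof.
move=> uA cA delta0 wA; have [c' [c'A c'w c'd]] := few_fractional w d uA cA.
exists (fun x => c' x == 1) => i id.
rewrite -c'w// big_mkcond -sumrB.
apply: (@le_trans _ _ (\sum_(x <- A) (0 < c' x < 1)%R%:R * delta)).
  apply: ler_norm_sum_in => x xA; have /andP[c0 c1] := c'A _ xA.
  have [->|c'1] := eqVneq (c' x) 1.
    by rewrite mul1r subrr normr0 ltxx andbF mul0r.
  rewrite (lt_neqAle _ 1) c'1 c1 (lt_neqAle 0) c0 !andbT.
  have [<-|c'0] := eqVneq 0 (c' x); first by rewrite !mul0r subrr normr0.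
  rewrite sub0r normrN normrM mul1r ger0_norm// -[leRHS]mul1r.
  by apply: ler_pM => //; exact: wA.
by rewrite -mulr_suml -natr_count ler_wpM2r// ler_nat.
Qed.

(* The weights [l] are the classical certificate of Steinitz: as their sum is
   [size A - d], a vertex of the polytope of admissible weights of sum
   [size A - d - 1] has a zero coordinate, which is put last. *)
Lemma steinitz_ordering (A : seq T) (l : T -> R) (w : T -> nat -> R) (d : nat)
    (delta b : R) :
  uniq A -> {in A, forall x, 0 <= l x <= 1} -> 0 <= delta -> 0 <= b ->
  (forall x i, x \in A -> (i < d)%N -> `|w x i| <= delta) ->
  ((d < size A)%N -> \sum_(x <- A) l x + d%:R = (size A)%:R) ->
  (forall i, (i < d)%N -> `|\sum_(x <- A) l x * w x i| <= b) ->
  exists2 s, perm_eq s A & forall i k, (i < d)%N ->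
    `|\sum_(x <- take k s) w x i| <= b + d%:R * delta.
Proof.
move=> + + delta0 b0; have [n] := ubnP (size A).
elim: n A l => // n IH A l nA uA lA wA lsum lw.
have [Ad|dA] := leqP (size A) d.
  exists A => // i k id; apply: (@le_trans _ _ (\sum_(x <- take k A) delta)).
    by apply: ler_norm_sum_in => x /mem_take xA; exact: wA.
  rewrite big_const_seq count_predT iter_addr_0 -[leLHS]mulr_natl -[leLHS]add0r lerD//.
  by rewrite ler_wpM2r// ler_nat (leq_trans _ Ad)// size_take_min geq_minr.
have {}lsum := lsum dA; pose m := (size A - d.+1)%N.
have Am : size A = (m + d.+1)%N by rewrite subnK.
have lm : \sum_(x <- A) l x = m.+1%:R.
  apply: (addIr d%:R); rewrite lsum Am -natrD; congr _%:R; lia.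
(* Scaling by [r] lowers the total weight from [m.+1] to [m], so admissible weights of the smaller
   sum exist. *)
pose r : R := m%:R / m.+1%:R.
have r0 : 0 <= r by rewrite divr_ge0 ?ler0n.
have r1 : r <= 1 by rewrite ler_pdivrMr ?ltr0n// mul1r ler_nat.
have rlA : {in A, forall x, 0 <= r * l x <= 1}.
  by move=> x /lA/andP[l0 l1]; rewrite mulr_ge0//= mulr_ile1.
(* The extra coordinate, constantly 1, makes the total weight one of the preserved sums. *)
pose w1 x i := if (i < d)%N then w x i else 1.
have [c [cA cw cd]] := few_fractional w1 d.+1 uA rlA.
have csum : \sum_(x <- A) c x = m%:R.
  have := cw d (ltnSn d); rewrite /w1 ltnn.
  under eq_bigr do rewrite mulr1.
  under [in RHS]eq_bigr do rewrite mulr1.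
  by rewrite -mulr_sumr lm /r divfK ?pnatr_eq0.
have [z zA cz] : exists2 z, z \in A & c z = 0.
  suff /hasP[z zA /eqP cz] : has (fun z => c z == 0) A by exists z.
  apply: contraT => /hasPn cn0.
  (* Without a zero weight, [g] is nonnegative, and positive at fractional weights. Its sum, the
     number of fractional weights minus [d.+1], is at most 0; being also nonnegative, it forces a
     fractional weight to exist, a contradiction. *)
  pose g x : R := (0 < c x < 1)%R%:R - (1 - c x).
  have gsum : \sum_(x <- A) g x =
      (count (fun x => 0 < c x < 1)%R A)%:R - d.+1%:R.
    rewrite /g !sumrB csum -natr_count big_const_seq count_predT iter_addr_0 Am.
    rewrite natrD; ring.
  have cgt0 x : x \in A -> 0 < c x.
    by move=> xA; rewrite lt_neqAle eq_sym cn0//; case/andP: (cA _ xA).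
  have g0 x : x \in A -> 0 <= g x.
    move=> xA; have /andP[c0 c1] := cA _ xA; rewrite /g (cgt0 _ xA) /=.
    by case: (ltP (c x) 1) => /= *; lra.
  have gs0 (B : seq T) : {subset B <= A} -> 0 <= \sum_(x <- B) g x.
    by move=> BA; rewrite big_seq sumr_ge0// => x /BA/g0.
  have : has (fun x => 0 < c x < 1) A.
    rewrite has_count -(ltr_nat R); have := gs0 A (fun=> id); rewrite gsum.
    have : 0 < d.+1%:R :> R by rewrite ltr0n.
    lra.
  case/hasP => z zA cz.
  have := gsum; rewrite (big_rem z)//= {1}/g cz.
  have := gs0 (rem z A) (@mem_rem _ z A).
  move: cz => /andP[cz0 _]; move: cd; rewrite -(ler_nat R) /=; lra.
have pz := perm_to_rem zA.
have sz : size A = (size (rem z A)).+1 by rewrite (perm_size pz).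
have [||||||s ps sP] := IH (rem z A) c.
- by rewrite -ltnS -sz.
- exact: rem_uniq.
- by move=> x /mem_rem/cA.
- by move=> x i /mem_rem; exact: wA.
- move=> _; have := csum; rewrite (big_rem z)//= cz add0r => ->.
  by rewrite -natrD; congr _%:R; lia.
- move=> i id; have := cw i (ltnW id); rewrite /w1 id (big_rem z)//= cz mul0r add0r.
  move=> ->; under eq_bigr do rewrite -mulrA.
  rewrite -mulr_sumr normrM (ger0_norm r0); apply: le_trans (lw i id).
  by rewrite -[leRHS]mul1r ler_wpM2r.
have psA : perm_eq (rcons s z) A.
  by rewrite perm_rcons (permPr pz) perm_cons.
exists (rcons s z) => // i k id; have [ks|ks] := leqP k (size s).
  by rewrite -cats1 takel_cat//; exact: sP.
rewrite take_oversize ?size_rcons// (perm_big _ psA) /=.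
(* The complementary weights [1 - l x] sum to [d], which gives the term [d%:R * delta]. *)
rewrite (_ : \sum_(x <- A) w x i =
  \sum_(x <- A) l x * w x i + \sum_(x <- A) (1 - l x) * w x i); last first.
  by rewrite -big_split; apply: eq_bigr => x _ /=; ring.
apply: le_trans (ler_normD _ _) _; apply: lerD; first exact: lw.
apply: (@le_trans _ _ (\sum_(x <- A) (1 - l x) * delta)).
  apply: ler_norm_sum_in => x xA; have /andP[l0 l1] := lA _ xA.
  by rewrite normrM ger0_norm ?subr_ge0// ler_wpM2l ?subr_ge0//; exact: wA.
rewrite -mulr_suml ler_wpM2r// sumrB big_const_seq count_predT iter_addr_0.
by rewrite -lsum addrAC subrr add0r.
Qed.

(** Steinitz' induction starts from constant weights of sum [size A - d]; truncated subtraction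
    makes them 0 when [A] has at most [d] elements. *)
Lemma bounded_ordering (A : seq T) (w : T -> nat -> R) (d : nat) (delta b : R) :
  uniq A -> 0 <= delta -> 0 <= b ->
  (forall x i, x \in A -> (i < d)%N -> `|w x i| <= delta) ->
  (forall i, (i < d)%N -> `|\sum_(x <- A) w x i| <= b) ->
  exists2 s, perm_eq s A & forall i k, (i < d)%N ->
    `|\sum_(x <- take k s) w x i| <= b + d%:R * delta.
Proof.
move=> uA delta0 b0 wA wb; pose r : R := (size A - d)%:R / (size A)%:R.
have r0 : 0 <= r by rewrite divr_ge0 ?ler0n.
have r1 : r <= 1.
  rewrite /r; case: (size A) => [|m]; first by rewrite mul0r.
  by rewrite ler_pdivrMr ?ltr0n// mul1r ler_nat leq_subr.
apply: (@steinitz_ordering A (fun=> r)) => //.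
- by move=> x _; rewrite r0.
- move=> dA; rewrite big_const_seq count_predT iter_addr_0 -[r *+ _]mulr_natr.
  rewrite divfK; last by rewrite pnatr_eq0 -lt0n (leq_ltn_trans _ dA).
  by rewrite -natrD subnK// ltnW.
- move=> i id; rewrite -mulr_sumr normrM (ger0_norm r0).
  by apply: le_trans (wb i id); rewrite -[leRHS]mul1r ler_wpM2r.
Qed.

End Vertex.

(** * Limits of finite sums and separation by a point of least norm *)

Lemma cvg_sumr (R : realType) (I : Type) (r : seq I) (f : I -> nat -> R)
    (l : I -> R) :
  (forall i, f i @ \oo --> l i) ->
  (fun n => \sum_(i <- r) f i n) @ \oo --> \sum_(i <- r) l i.
Proof.
move=> fl; elim: r => [|i r IH].
  by under eq_cvg do rewrite big_nil; rewrite big_nil; exact: cvg_cst.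
by under eq_cvg do rewrite big_cons; rewrite big_cons; exact: cvgD.
Qed.

Section MinNorm.
Variables (R : realType) (d : nat).
Implicit Types p q : nat -> R.

Let dot p q := \sum_(i < d) p i * q i.

Let dot_comb p q s t : dot (fun i => s * p i + t * q i) (fun i => s * p i + t * q i) =
  s ^+ 2 * dot p p + 2 * s * t * dot q p + t ^+ 2 * dot q q.
Proof. by rewrite /dot !mulr_sumr -!big_split /=; apply: eq_bigr => i _; ring. Qed.

Let dot_ge0 p : 0 <= dot p p.
Proof. by apply: sumr_ge0 => i _; rewrite -expr2 sqr_ge0. Qed.

Let cvg_dot (p q : nat -> nat -> R) (p' q' : nat -> R) :
  (forall i, (i < d)%N -> p ^~ i @ \oo --> p' i) ->
  (forall i, (i < d)%N -> q ^~ i @ \oo --> q' i) ->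
  (fun k => dot (p k) (q k)) @ \oo --> dot p' q'.
Proof.
move=> pp' qq'; apply: cvg_sumr => i.
by apply: cvgM; [exact: pp'|exact: qq'].
Qed.

(* [s] is the point of least norm of the closure of [P]; it is reached by a
   minimizing sequence, which is Cauchy by the parallelogram law. *)
Lemma min_norm_separation (P : set (nat -> R)) (e : R) :
  P !=set0 ->
  (forall p q t, P p -> P q -> 0 <= t <= 1 ->
    P (fun i => (1 - t) * p i + t * q i)) ->
  (forall p, P p -> e <= \sum_(i < d) p i ^+ 2) ->
  exists s : nat -> R, forall p, P p -> e <= \sum_(i < d) s i * p i.
Proof.
move=> P0 Pconv Pe.
pose E := [set dot p p | p in P].
have E0 : E !=set0 by have [p Pp] := P0; exists (dot p p); exists p.
have Elb : has_lbound E by exists 0 => _ [p _ <-]; exact: dot_ge0.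
pose m := inf E.
have mP p : P p -> m <= dot p p by move=> Pp; apply: ge_inf => //; exists p.
have em : e <= m.
  apply: lb_le_inf => // _ [p Pp <-]; apply: le_trans (Pe _ Pp) _.
  by rewrite /dot; under eq_bigr do rewrite expr2.
have /choice[p pP] : forall k, exists p, P p /\ dot p p < m + k.+1%:R^-1.
  move=> k; have k0 : 0 < k.+1%:R^-1 :> R by rewrite invr_gt0.
  have [_ [p Pp <-] pm] := inf_adherent k0 (conj E0 Elb).
  by exists p.
have pdist k l i : (i < d)%N ->
    (p k i - p l i) ^+ 2 <= 2 * k.+1%:R^-1 + 2 * l.+1%:R^-1.
  move=> id; have [[Pk pk] [Pl pl]] := (pP k, pP l).
  (* The midpoint of [p k] and [p l] lies in [P], so its squared norm is at least [m]; this bounds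
     the distance of the two points. *)
  have := mP _ (@Pconv _ _ 2^-1 Pk Pl _); rewrite dot_comb.
  move=> /(_ ltac:(apply/andP; split; lra)) h.
  have -> : (p k i - p l i) ^+ 2 =
      (1 * p k i + -1 * p l i) * (1 * p k i + -1 * p l i) by ring.
  have : (1 * p k i + -1 * p l i) * (1 * p k i + -1 * p l i) <=
    dot (fun i => 1 * p k i + -1 * p l i) (fun i => 1 * p k i + -1 * p l i).
    rewrite /dot (bigD1 (Ordinal id))//= lerDl.
    by apply: sumr_ge0 => j _; rewrite -expr2 sqr_ge0.
  rewrite dot_comb; move: pk pl h.
  move: (k.+1%:R^-1) (l.+1%:R^-1) (dot (p k) (p k)) (dot (p l) (p l)).
  by move=> *; lra.
have pcvg i : (i < d)%N -> cvgn (p ^~ i).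
  move=> id; apply/cauchy_cvgP/cauchy_exP => eps eps0.
  have [k _ kE] : \forall k \near \oo, 4 * k.+1%:R^-1 < eps ^+ 2.
    have : (fun k => 4 * k.+1%:R^-1) @ \oo --> 4 * (0:R).
      by apply: cvgMr; exact: cvg_harmonic.
    by rewrite mulr0 => /cvgr_lt; apply; rewrite exprn_gt0.
  exists (p k i); exists k => // l /= kl.
  rewrite -ball_normE /= -ltr_sqr ?nnegrE ?normr_ge0 ?(ltW eps0)//.
  rewrite real_normK ?num_real//.
  apply: le_lt_trans (pdist _ _ _ id) (le_lt_trans _ (kE k _)) => //=.
  have : l.+1%:R^-1 <= k.+1%:R^-1 :> R by rewrite lef_pV2 ?posrE// ler_nat.
  by move: (k.+1%:R^-1) (l.+1%:R^-1) => *; lra.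
pose q i := limn (p ^~ i).
have pq i : (i < d)%N -> p ^~ i @ \oo --> q i by move/pcvg.
have qm : dot q q <= m.
  have mc : (fun k => m + k.+1%:R^-1) @ \oo --> m + 0.
    by apply: cvgD; [exact: cvg_cst|exact: cvg_harmonic].
  rewrite -[m]addr0; apply: ler_cvg_to (cvg_dot pq pq) mc _.
  by near=> k; have [_ /ltW] := pP k.
(* [q] need not lie in [P], but a segment from [q] to a point of [P] is a limit of segments within
   [P]. *)
have qP r t : P r -> 0 <= t <= 1 ->
    m <= (1 - t) ^+ 2 * dot q q + 2 * (1 - t) * t * dot r q + t ^+ 2 * dot r r.
  move=> Pr t01; rewrite -dot_comb.
  have pqt i : (i < d)%N -> (fun k => (1 - t) * p k i + t * r i) @ \oo -->
      (1 - t) * q i + t * r i.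
    by move=> id; apply: cvgD; [apply: cvgMr; exact: pq|exact: cvg_cst].
  apply: cvgr_to_ge (cvg_dot pqt pqt) _.
  by near=> k; apply/mP/Pconv => //; have [] := pP k.
exists q => r Pr; apply: le_trans em _.
rewrite leNgt; apply/negP => qr.
have rq : dot r q < m by rewrite /dot; under eq_bigr do rewrite mulrC.
pose g := m - dot r q.
have g0 : 0 < g by rewrite subr_gt0.
have rr := dot_ge0 r.
pose h := dot r r + 2 * g.
have h0 : 0 < h by rewrite /h; lra.
(* Moving from [q] towards [r] by the fraction [t] gives squared norm at most
   [m - 2 * t * g + t ^+ 2 * h], which [g / h] minimizes to a value below [m]. *)
pose t := g / h.
have t0 : 0 < t by rewrite divr_gt0.
have t1 : t <= 1 by rewrite ler_pdivrMr // /h; lra.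
have := qP r t Pr; rewrite (ltW t0) t1 => /(_ isT) H.
have th : t * h = g by rewrite divfK// gt_eqF.
have : (1 - t) ^+ 2 * dot q q <= (1 - t) ^+ 2 * m by rewrite ler_wpM2l ?sqr_ge0.
rewrite /g in th g0.
have : t * (t * h) = t * g by rewrite th.
have := mulr_gt0 t0 g0; rewrite /h /g.
have := le_trans (dot_ge0 q) qm => m0.
have := mulr_ge0 (sqr_ge0 t) m0.
lra.
Unshelve. all: by end_near. Qed.

End MinNorm.

(** * Approximation of elements of R(a) by finite sums over tails *)

Lemma near_forall_lt (T : Type) (F : set_system T) (P : nat -> T -> Prop) (d : nat) :
  Filter F -> (forall i, \forall x \near F, P i x) ->
  \forall x \near F, forall i, (i < d)%N -> P i x.
Proof.
move=> FF FP; elim: d => [|d IH]; first exact: filterE.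
have Pd := FP d; near=> x => i; rewrite ltnS leq_eqVlt => /predU1P[->|].
  by near: x.
by move: i; near: x.
Unshelve. all: by end_near. Qed.

(** The absolute value is twice the positive part minus [u], and convergence bounds the partial sums
    of [u] from below. *)
Lemma abs_convergent_pos_part (R : realType) (u : R ^nat) (M : nat) (b : R) :
  cvgn (series u) -> (forall N, \sum_(M <= n < N | 0 < u n) u n <= b) ->
  abs_convergent u.
Proof.
move=> uc ub; rewrite /abs_convergent.
rewrite -(@is_cvg_series_restrict M).
apply: nondecreasing_is_cvgn.
  by apply: (@nondecreasing_series _ _ xpredT) => n _ _ /=.
have : cvgn (fun n => \sum_(M <= k < n) u k) by rewrite is_cvg_series_restrict.
move=> /cvg_seq_bounded/bounded_fun_has_lbound[c cP].
exists (2 * b - c) => _ [n _ <-].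
apply: (@le_trans _ _ (2 * (\sum_(M <= k < n | 0 < u k) u k) - \sum_(M <= k < n) u k)).
  rewrite le_eqVlt; apply/orP; left; apply/eqP.
  rewrite (big_mkcond (fun k => 0 < u k)) mulr_sumr -sumrB.
  apply: eq_bigr => k _ /=; case: (ltP 0 (u k)) => uk.
    by rewrite gtr0_norm//; ring.
  by rewrite ler0_norm//; ring.
apply: lerB; first by rewrite ler_wpM2l.
by apply: cP; exists n.
Qed.

Lemma fsbig_below (R : realType) (d : nat) (f : nat -> R) :
  (forall i, (d <= i)%N -> f i = 0) -> \sum_(i \in [set: nat]) f i = \sum_(i < d) f i.
Proof.
move=> f0; rewrite fsbig_ord; apply/esym/fsbig_widen => // i [_ /=].
by move/negP; rewrite -leqNgt => /f0.
Qed.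

Lemma cvg_series_lincomb (R : realType) (b : nat -> nat -> R) (l : nat -> R)
    (d : nat) (s : nat -> R) :
  (forall i, series (b i) @ \oo --> l i) ->
  series (fun n => \sum_(i < d) s i * b i n) @ \oo --> \sum_(i < d) s i * l i.
Proof.
move=> bl; have -> : series (fun n => \sum_(i < d) s i * b i n) =
    fun n => \sum_(i < d) s i * series (b i) n.
  apply/funext => n; rewrite /series /= exchange_big /=.
  by apply: eq_bigr => i _; rewrite mulr_sumr.
apply: (cvg_sumr (f := fun (i : 'I_d) n => s i * series (b i) n)) => i.
exact: cvgMr.
Qed.

Section Density.
Variables (R : realType) (a : nat -> nat -> R).
Hypothesis acvg : forall i, cvgn (series (a i)).

Let comb (M N : nat) (c : nat -> R) i := \sum_(M <= n < N) c n * a i n.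

Lemma comb_widen M N N' c i : (N <= N')%N ->
  comb M N c i = comb M N' (fun n => if (n < N)%N then c n else 0) i.
Proof.
move=> NN'; rewrite /comb (big_nat_widen _ _ _ _ _ NN') big_mkcond /=.
by apply: eq_bigr => n _; case: ifP => // _; rewrite mul0r.
Qed.

Lemma weights_dense (x : nat -> R) (d M : nat) (e : R) :
  Rspace a x -> 0 < e ->
  exists N (c : nat -> R), (forall n, 0 <= c n <= 1) /\
    forall i, (i < d)%N -> `|\sum_(M <= n < N) c n * a i n - x i| <= e.
Proof.
move=> Rx e0; apply: contrapT => far.
(* If approximation fails, this convex set of errors stays at distance at least [e] from 0 in the
   first [d] coordinates, so a functional [s] separates it from 0. *)
pose P := [set p : nat -> R | exists N (c : nat -> R),
  (forall n, 0 <= c n <= 1) /\ p = fun i => comb M N c i - x i].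
have [|||s sP] := @min_norm_separation R d P (e ^+ 2).
- exists (fun i => comb M 0 (fun=> 0) i - x i), 0%N, (fun=> 0).
  by split=> // n; rewrite lexx ler01.
- move=> _ _ t [N1 [c1 [c1P ->]]] [N2 [c2 [c2P ->]]] /andP[t0 t1].
  exists (maxn N1 N2), (fun n => (1 - t) * (if (n < N1)%N then c1 n else 0) +
    t * (if (n < N2)%N then c2 n else 0)); split.
    move=> n; have /andP[? ?] := c1P n; have /andP[? ?] := c2P n.
    by apply/andP; split; case: ifP => _; case: ifP => _; nra.
  apply/funext => i.
  rewrite (comb_widen _ _ _ (leq_maxl N1 N2)) (comb_widen _ _ _ (leq_maxr N1 N2)).
  rewrite [in RHS]/comb; under eq_bigr do rewrite mulrDl -!mulrA.
  by rewrite big_split /= -!mulr_sumr -/(comb _ _ _ _) -/(comb _ _ _ _); ring.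
- move=> _ [N [c [cP ->]]]; rewrite leNgt; apply/negP => small.
  apply: far; exists N, c; split=> // i id.
  rewrite -ler_sqr ?nnegrE ?normr_ge0 ?(ltW e0)// real_normK ?num_real//.
  apply: le_trans (ltW small); rewrite (bigD1 (Ordinal id))//= lerDl.
  by apply: sumr_ge0 => j _; exact: sqr_ge0.
pose u n := \sum_(i < d) (- s i) * a i n.
pose b := - (e ^+ 2) - \sum_(i < d) s i * x i.
have ub N : \sum_(M <= n < N | 0 < u n) u n <= b.
  (* Taking the indicator of the positive terms of [u] as weights turns the separating inequality
     into a bound on the positive parts. *)
  pose c n : R := (0 < u n)%R%:R.
  have := sP (fun i => comb M N c i - x i); rewrite /b.
  have -> : \sum_(M <= n < N | 0 < u n) u n = - \sum_(i < d) s i * comb M N c i.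
    rewrite /comb; under [in RHS]eq_bigr do rewrite mulr_sumr.
    rewrite [X in _ = - X]exchange_big /= big_mkcond -sumrN; apply: eq_bigr => n _.
    rewrite /c; case: (0 < u n) => /=.
      by rewrite /u -sumrN; apply: eq_bigr => i _; ring.
    by rewrite big1 ?oppr0// => i _; ring.
  under eq_bigr do rewrite mulrBr.
  rewrite sumrB => h; suff : P (fun i => comb M N c i - x i) by move/h; lra.
  by exists N, c; split=> // n; rewrite /c ler0n lern1 leq_b1.
have uabs : abs_convergent u.
  apply: (@abs_convergent_pos_part R u M b _ ub).
  exact: cvgP (@cvg_series_lincomb _ _ _ d (fun i => - s i) acvg).
pose s' i := if (i < d)%N then - s i else 0.
have s'K : Kspace a s'.
  split; first apply: (sub_finite_set _ (finite_II d)).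
    by move=> i /=; rewrite /s'; case: ifP => //; rewrite eqxx.
  rewrite (_ : (fun n => _) = u)//; apply/funext => n.
  rewrite (@fsbig_below _ d).
    by apply: eq_bigr => i _; rewrite /s' ltn_ord.
  by move=> i di; rewrite /s' ltnNge di mul0r.
have := Rx _ s'K; rewrite (@fsbig_below _ d); last first.
  by move=> i di; rewrite /s' ltnNge di mulr0.
(* The empty sum gives [0 <= b], whereas orthogonality to [s'] reduces [b] to [- (e ^+ 2)]. *)
have := ub 0%N; rewrite big_geq// /b.
have -> : \sum_(i < d) x i * s' i = - \sum_(i < d) s i * x i.
  by rewrite -sumrN; apply: eq_bigr => i _; rewrite /s' ltn_ord; ring.
have : 0 < e ^+ 2 by rewrite exprn_gt0.
lra.
Qed.

Lemma terms_small (d : nat) (e : R) : 0 < e ->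
  \forall n \near \oo, forall i, (i < d)%N -> `|a i n| <= e.
Proof.
move=> e0; apply: near_forall_lt => i.
have /cvgr0Pnorm_le := cvg_series_cvg_0 (@acvg i); exact.
Qed.

(** Half of [e] is spent on the fractional weights and half on rounding them; the tail starts late
    enough for the relevant terms to be at most [delta]. *)
Lemma subset_sums_dense (x : nat -> R) (d M : nat) (e : R) :
  Rspace a x -> 0 < e ->
  exists A : seq nat, [/\ uniq A, forall n, n \in A -> (M <= n)%N &
    forall i, (i < d)%N -> `|\sum_(n <- A) a i n - x i| <= e].
Proof.
move=> Rx e0; pose delta := e / 2 / d.+1%:R.
have delta0 : 0 < delta by rewrite !divr_gt0.
have [M1 _ M1P] := terms_small d delta0.
have e20 : 0 < e / 2 by rewrite divr_gt0.
have [N [c [c01 cP]]] := weights_dense d (maxn M M1) Rx e20.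
have [] := @subset_rounding R nat (index_iota (maxn M M1) N) c (fun n i => a i n)
  d delta (iota_uniq _ _) (fun n _ => c01 n) (ltW delta0).
  move=> n i; rewrite mem_index_iota geq_max => /andP[/andP[_ M1n] _].
  by apply: M1P.
move=> P PP; exists [seq n <- index_iota (maxn M M1) N | P n]; split.
- by rewrite filter_uniq// iota_uniq.
- by move=> n; rewrite mem_filter mem_index_iota geq_max => /and3P[_ /andP[]].
- move=> i id; rewrite big_filter.
  have := PP i id; have := cP i id.
  have : d%:R * delta <= e / 2.
    rewrite /delta mulrCA ler_piMr ?(ltW e20)// ler_pdivrMr ?ltr0n// mul1r ler_nat.
    exact: leqnSn.
  rewrite !ler_norml => h /andP[? ?] /andP[? ?].
  by apply/andP; split; lra.
Qed.

End Density.

(** * Rearrangement of absolutely convergent series *)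

Lemma seq_nat_bounded (A : seq nat) : exists M, forall n, n \in A -> (n < M)%N.
Proof.
exists (\max_(n <- A) n)%N.+1 => n nA; rewrite ltnS.
exact: (@leq_bigmax_seq _ _ xpredT id).
Qed.

(** Beyond a suitable [N] the absolute values sum to at most [e], and [A] adds to the first [N]
    indices only distinct indices beyond them. *)
Lemma abs_convergent_tail (R : realType) (u : R ^nat) (e : R) :
  abs_convergent u -> 0 < e ->
  exists N, forall A : seq nat, uniq A -> {subset iota 0 N <= A} ->
    `|\sum_(n <- A) u n - series u N| <= e.
Proof.
move=> uabs e0; pose v := series (fun n => `|u n|).
have vnd : nondecreasing_seq v by apply: (@nondecreasing_series _ _ xpredT).
have /cvgrPdist_le/(_ _ e0)[N _ NP] : v @ \oo --> limn v by exact: uabs.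
exists N => A uA NA; have [M0 M0P] := seq_nat_bounded A.
pose M := maxn M0 N.
have NM : (N <= M)%N := leq_maxr _ _.
have AE : perm_eq A (index_iota 0 N ++ [seq n <- index_iota N M | n \in A]).
  apply: uniq_perm => //.
    rewrite cat_uniq iota_uniq filter_uniq ?iota_uniq// andbT.
    apply/hasPn => n; rewrite mem_filter mem_index_iota => /and3P[_ Nn _].
    by rewrite mem_index_iota/= -leqNgt.
  move=> n; rewrite mem_cat mem_filter !mem_index_iota /=.
  case: (ltnP n N) => /= nN; first by rewrite NA// mem_iota.
  case nA: (n \in A) => //=; by rewrite /M leq_max M0P.
rewrite (perm_big _ AE) big_cat /= -[X in X + _ - _]/(series u N) addrC addKr big_filter.
apply: le_trans (ler_norm_sum _ _ _) _.
apply: (@le_trans _ _ (\sum_(N <= n < M) `|u n|)).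
  by rewrite big_mkcond; apply: ler_sum => n _; case: ifP.
have -> : \sum_(N <= n < M) `|u n| = v M - v N by rewrite sub_series_geq.
have := NP N (leqnn _); rewrite /= ler_norml => /andP[_].
by have := nondecreasing_cvgn_le vnd uabs M; lra.
Qed.

(** In both orders, long partial sums contain the first [N] terms, so both are within [e / 2] of
    [series u N]. *)
Lemma abs_convergent_rearrange (R : realType) (u : R ^nat) (p : nat -> nat) (l : R) :
  abs_convergent u -> bijective p ->
  series (u \o p) @ \oo --> l -> series u @ \oo --> l.
Proof.
move=> uabs [q pK qK] ul.
suff : (series (u \o p) \- series u) n @[n --> \oo] --> 0.
  move=> d0; have -> : series u = series (u \o p) - (series (u \o p) \- series u).
    by apply/funext => n /=; rewrite !fctE /= opprB addrC subrK.
  by rewrite -[l]subr0; exact: cvgB ul d0.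
apply/cvgrPdist_le => e e0.
have e20 : 0 < e / 2 by rewrite divr_gt0.
have [N NP] := abs_convergent_tail uabs e20.
(* [M] exceeds every position at which [p] takes a value below [N]. *)
have [M MP] := seq_nat_bounded (map q (iota 0 N)).
exists (maxn M N) => // n; rewrite /= geq_max => /andP[Mn Nn].
have /NP : uniq (map p (index_iota 0 n)).
  by rewrite map_inj_uniq ?iota_uniq//; exact: can_inj pK.
have /NP : uniq (index_iota 0 n) by exact: iota_uniq.
move=> /(_ _)-h1 /(_ _)-h2.
have {h1} : `|series u n - series u N| <= e / 2.
  by apply: h1 => k; rewrite mem_iota mem_index_iota => /= kN; exact: leq_trans Nn.
have {h2} : `|series (u \o p) n - series u N| <= e / 2.
  rewrite [X in `|X - _|](_ : _ = \sum_(n <- [seq p n | n <- index_iota 0 n]) u n).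
    apply: h2 => k kN; rewrite -(qK k) map_f// mem_index_iota /=.
    by apply: leq_trans Mn; apply: MP; exact: map_f.
  by rewrite big_map.
rewrite sub0r normrN !ler_norml /= => /andP[? ?] /andP[? ?].
by apply/andP; split; lra.
Qed.

(** * Construction by blocks of a permutation with prescribed sums *)

Section Rearrangement.
Variables (R : realType) (a : nat -> nat -> R) (x : nat -> R).
Hypothesis acvg : forall i, cvgn (series (a i)).
Hypothesis Rx : Rspace a x.

Let t i := limn (series (a i)) + x i.

(** [F] is first completed to a long initial segment, whose sums are near those of the series; a
    finite subset of the tail then contributes approximately [x]. *)
Lemma extend_finite_sum (F : seq nat) (d M : nat) (e : R) : uniq F -> 0 < e ->
  exists G, [/\ uniq (F ++ G), forall n, (n < M)%N -> n \in F ++ G &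
    forall i, (i < d)%N -> `|\sum_(n <- F ++ G) a i n - t i| <= e].
Proof.
move=> uF e0; have e20 : 0 < e / 2 by rewrite divr_gt0.
have [M1 M1P] := seq_nat_bounded F.
have [M2 _ M2P] : \forall n \near \oo, forall i, (i < d)%N ->
    `|limn (series (a i)) - series (a i) n| <= e / 2.
  by apply: near_forall_lt => i; have /cvgrPdist_le := @acvg i; exact.
pose N := maxn M (maxn M1 M2).
have [A [uA AN AP]] := subset_sums_dense acvg d N Rx e20.
exists ([seq n <- iota 0 N | n \notin F] ++ A).
have FN n : n \in F -> (n < N)%N by move=> /M1P nM1; rewrite !leq_max nM1 orbT.
have pG : perm_eq (F ++ [seq n <- iota 0 N | n \notin F] ++ A) (index_iota 0 N ++ A).
  rewrite catA perm_cat2r; apply: uniq_perm; last 1 first.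
  - move=> n; rewrite mem_cat mem_filter mem_iota mem_index_iota /=.
    by case nF: (n \in F) => //=; rewrite FN.
  - rewrite cat_uniq uF filter_uniq ?iota_uniq// andbT.
    by apply/hasPn => n; rewrite mem_filter => /andP[].
  - exact: iota_uniq.
split.
- rewrite (perm_uniq pG) cat_uniq iota_uniq uA andbT.
  by apply/hasPn => n /AN; rewrite mem_index_iota /= -leqNgt.
- move=> n nM; rewrite (perm_mem pG) mem_cat mem_index_iota /=.
  by rewrite (leq_trans nM) // leq_maxl.
- move=> i id; rewrite (perm_big _ pG) big_cat /=.
  have := AP i id; have := M2P N _ i id; rewrite /= !leq_max leqnn !orbT => /(_ isT).
  rewrite /t /series /= !ler_norml => /andP[? ?] /andP[? ?].
  by apply/andP; split; lra.
Qed.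

(** Quadratic decay absorbs the factor [k] of Steinitz' bound: [k.+2%:R * e k] is [k.+2%:R^-1]. *)
Let e k : R := k.+2%:R^-1 ^+ 2.

(** Invariant of stage [k]; smallness of the terms outside [F] is what Steinitz' ordering of the
    next block requires. *)
Let good k (F : seq nat) := [/\ uniq F, forall n, (n < k)%N -> n \in F,
  forall i n, (i < k)%N -> n \notin F -> `|a i n| <= e k &
  forall i, (i < k)%N -> `|\sum_(n <- F) a i n - t i| <= e k].

Let e_gt0 k : 0 < e k. Proof. by rewrite exprn_gt0// invr_gt0. Qed.

(** The sums over [F] and over its extension are both near [t], so the new block has a small sum,
    and Steinitz' ordering keeps its initial sums small too. *)
Lemma good_step k F : good k F -> exists G, good k.+1 (F ++ G) /\
  forall i j, (i < k)%N ->
    `|\sum_(n <- F ++ take j G) a i n - t i| <= 2 * k.+1%:R^-1.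
Proof.
move=> [uF kF aF tF].
have [M _ MP] := terms_small acvg k.+1 (e_gt0 k.+1).
have [G [uG MG tG]] := extend_finite_sum k.+1 (maxn M k.+1) uF (e_gt0 k.+1).
have uG' : uniq G by move: uG; rewrite cat_uniq => /and3P[].
have [||||G' GG' G'P] := @bounded_ordering R nat G (fun n i => a i n) k (e k)
  (e k + e k.+1) uG'.
- exact: ltW.
- by rewrite addr_ge0// ltW.
- move=> n i nG ik; apply: aF => //.
  by move: uG; rewrite cat_uniq => /and3P[_ /hasPn/(_ _ nG)].
- move=> i ik; have := tG i (ltnW ik); have := tF i ik; rewrite big_cat /=.
  by rewrite !ler_norml => /andP[? ?] /andP[? ?]; apply/andP; split; lra.
have FG : perm_eq (F ++ G') (F ++ G) by rewrite perm_cat2l.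
exists G'; split; first split.
- by rewrite (perm_uniq FG).
- by move=> n nk; rewrite (perm_mem FG) MG// leq_max nk orbT.
- move=> i n ik; rewrite (perm_mem FG) => nFG; apply: MP => //=.
  by rewrite leqNgt; apply: contra nFG => nM; rewrite MG// leq_max nM.
- by move=> i ik; rewrite (perm_big _ FG) tG.
move=> i j ik; rewrite big_cat /=.
(* Error on [F], bound on the block sum and Steinitz' term, in this order. *)
have : e k + (e k + e k.+1) + k%:R * e k <= 2 * k.+1%:R^-1.
  have -> : e k + (e k + e k.+1) + k%:R * e k = k.+2%:R * e k + e k.+1.
    by rewrite -[k.+2]addn2 natrD; ring.
  have -> : k.+2%:R * e k = k.+2%:R^-1 by rewrite /e expr2 mulVKf// pnatr_eq0.
  have h m : (k <= m)%N -> m.+1%:R^-1 <= k.+1%:R^-1 :> R.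
    by move=> km; rewrite lef_pV2 ?posrE// ler_nat.
  rewrite mulr_natl mulr2n lerD ?h//; apply: le_trans (h k.+2 _); last by lia.
  by rewrite /e expr2 ler_piMl// invf_le1// ler1n.
have := tF i ik; have := G'P i j ik.
move: (e k) (e k.+1) (k.+1%:R^-1) => ek ek1 ik1.
rewrite !ler_norml => /andP[? ?] /andP[? ?] ?.
by apply/andP; split; lra.
Qed.

(** The blocks are concatenated. Absence of repetitions in each [F k] makes [p] injective,
    membership of [n] in [F n.+1] makes it surjective, and every partial sum ends inside a block,
    where it is controlled. *)
Lemma rearrangement_exists : exists2 p : nat -> nat, bijective p &
  forall i, series (fun n => a i (p n)) @ \oo --> t i.
Proof.
have /choice[step stepP] : forall kF : nat * seq nat, exists G,
    good kF.1 kF.2 -> good kF.1.+1 (kF.2 ++ G) /\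
    forall i j, (i < kF.1)%N ->
      `|\sum_(n <- kF.2 ++ take j G) a i n - t i| <= 2 * kF.1.+1%:R^-1.
  move=> [k F]; have [/good_step[G GP]|nG] := pselect (good k F); first by exists G.
  (* Dummy value for pairs violating the invariant. *)
  by exists [::].
pose fix F k := if k is k'.+1 then F k' ++ step (k', F k') else [::].
have FS k : F k.+1 = F k ++ step (k, F k) by [].
have Fgood k : good k (F k).
  by elim: k => [|k /(stepP (k, F k))[]//]; split.
have Fpre k l : (k <= l)%N -> prefix (F k) (F l).
  elim: l => [|l IH]; first by rewrite leqn0 => /eqP->; exact: prefix_refl.
  rewrite leq_eqVlt => /predU1P[->|]; first exact: prefix_refl.
  by rewrite ltnS => /IH/prefix_trans; apply; exact: prefix_prefix.
have Fsize k : (k <= size (F k))%N.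
  have [_ kF _ _] := Fgood k; rewrite -[leqLHS](size_iota 0).
  by apply: uniq_leq_size (iota_uniq _ _) _ => n; rewrite mem_iota => /kF.
(* [F n.+1] has more than [n] entries, so the default 0 is never read. *)
pose p n := nth 0%N (F n.+1) n.
have pE k n : (n < size (F k))%N -> nth 0%N (F k) n = p n.
  have key l m : (l <= m)%N -> (n < size (F l))%N -> nth 0%N (F m) n = nth 0%N (F l) n.
    by move=> /Fpre/prefixP[s ->] nl; rewrite nth_cat nl.
  move=> nk; case: (leqP k n.+1) => [kn|/ltnW nk1]; first by rewrite /p (key k).
  by rewrite /p (key n.+1).
have pF k n : (n <= size (F k))%N -> map p (iota 0 n) = take n (F k).
  move=> nk; apply: (@eq_from_nth _ 0%N); rewrite size_map size_iota ?size_takel//.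
  move=> j jn; rewrite (nth_map 0%N) ?size_iota// nth_iota// nth_take// add0n pE//.
  exact: leq_trans nk.
exists p.
  rewrite -setTT_bijective; split=> //.
    move=> n m _ _ pnm; pose k := (maxn n m).+1.
    have lt_k j : (j <= maxn n m)%N -> (j < size (F k))%N.
      by move=> jk; exact: leq_trans (Fsize k).
    have [uF _ _ _] := Fgood k.
    apply/eqP; rewrite -(nth_uniq 0%N _ _ uF) ?lt_k ?leq_maxl ?leq_maxr//.
    by rewrite !pE ?lt_k ?leq_maxl ?leq_maxr// pnm.
  move=> n _; have [_ /(_ n (ltnSn n)) nF _ _] := Fgood n.+1.
  by exists (index n (F n.+1)); rewrite // -(@pE n.+1) ?index_mem// nth_index.
move=> i; apply/cvgrPdist_le => eps eps0.
have [K _ KP] : \forall k \near \oo, 2 * k.+1%:R^-1 <= eps.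
  have : (fun k => 2 * k.+1%:R^-1) @ \oo --> 2 * (0:R).
    by apply: cvgMr; exact: cvg_harmonic.
  by rewrite mulr0 => /cvgr_le; apply.
(* Coordinate [i] is controlled only from stage [i.+1] on. *)
pose K' := maxn K i.+1.
exists (size (F K')) => // m /= Km.
have mex : exists k, (m < size (F k.+1))%N by exists m; exact: Fsize.
(* The least such [k] is the block into which position [m] falls. *)
case: (ex_minnP mex) => k mk kmin.
have km : (size (F k) <= m)%N.
  by case: k kmin {mk} => // k kmin; rewrite leqNgt; apply/negP => /kmin; rewrite ltnn.
have Kk : (K' <= k)%N.
  rewrite leqNgt; apply/negP => /Fpre/size_prefix; rewrite leqNgt => /negP; apply.
  exact: leq_ltn_trans mk.
have [_ /(_ i (m - size (F k))%N)] := stepP (k, F k) (Fgood k).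
move=> /(_ (leq_trans (leq_maxr _ _) Kk)) /= h.
rewrite distrC; apply: le_trans (KP k (leq_trans (leq_maxl _ _) Kk)).
apply: le_trans h.
rewrite [X in `|X - _|](_ : _ = \sum_(n <- map p (index_iota 0 m)) a i n).
  by rewrite /index_iota subn0 (@pF k.+1) ?(ltnW mk)// FS take_cat ltnNge km.
by rewrite big_map.
Qed.

End Rearrangement.

(** * The sum range as a translate of R(a) *)

Theorem theorem3p1 (R : realType) (a : nat -> nat -> R)
    (ha : forall i : nat, cond_convergent (a i)) :
  sum_range a = [set (fun i : nat => limn (series (a i)) + x i) | x in Rspace a].
Proof.
have acvg i : cvgn (series (a i)) by have [] := ha i.
apply/seteqP; split=> [y [p pbij py]|_ [x Rx <-]]; last first.
  exact: rearrangement_exists.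
exists (fun i => y i - limn (series (a i))); last first.
  by apply/funext => i; rewrite addrC subrK.
move=> s [/finite_seqP[A sA] sabs]; have [d dP] := seq_nat_bounded A.
have s0 i : (d <= i)%N -> s i = 0.
  apply: contraTeq => si; have : [set i | s i != 0] i by [].
  by rewrite sA -ltnNge => /dP.
pose u n := \sum_(i < d) s i * a i n.
have uabs : abs_convergent u.
  rewrite (_ : u = fun n => \sum_(i \in [set: nat]) s i * a i n)//.
  by apply/funext => n; rewrite (@fsbig_below _ d)// => i /s0 ->; rewrite mul0r.
rewrite (@fsbig_below _ d) => [|i /s0 ->]; last by rewrite mulr0.
have up := @cvg_series_lincomb _ _ _ d s py.
have ul := @cvg_series_lincomb _ _ _ d s acvg.
(* The absolutely convergent combination has the same sum in both orders, so [s] is orthogonal to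
   the difference of the two vectors of sums. *)
have E := cvg_unique _ (abs_convergent_rearrange uabs pbij up) ul.
under eq_bigr do rewrite mulrC mulrBr.
by rewrite sumrB E ?subrr//; exact: norm_hausdorff.
Qed.
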